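(* Every separable Fréchet–Urysohn $\alpha_2$ space $X$ is $H$-separable.
   Context: A set $S$ converges to a point $x$ of a space $X$ if $S\setminus U$ is finite for every open neighbourhood $U$ of $x$. A space $X$ is Fréchet–Urysohn if for every $A\subset X$ and $x\in\overline{A}\setminus A$ there is an infinite countable set $S\subset A\setminus\{x\}$ converging to $x$. For $x\in X$ let $\Gamma_x$ be the set of all infinite countable $A\subset X\setminus\{x\}$ which converge to $x$. The space $X$ is an $\alpha_2$ space if for every $x\in X$ and every sequence $\langle S_n:n\in\omega\rangle$ of elements of $\Gamma_x$ there is $S\in\Gamma_x$ such that $S_n\cap S$ is infinite for all $n\in\omega$. A space $X$ is $H$-separable if for every sequence $\langle D_n:n\in\omega\rangle$ of dense subsets of $X$ there are finite sets $F_n\subset D_n$, $n\in\omega$, such that every nonempty open subset of $X$ meets all but finitely many of the $F_n$. *)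

(* Defs.v *)
From mathcomp Require Import all_boot all_classical topology.

Set Implicit Arguments.
Unset Strict Implicit.
Unset Printing Implicit Defensive.

Local Open Scope classical_set_scope.

Definition converges_to (X : topologicalType) (S : set X) (x : X) : Prop :=
  forall U : set X, open U -> U x -> finite_set (S `\` U).

(* The family written Gamma_x in the literature on the alpha_i properties. *)
Definition Gamma (X : topologicalType) (x : X) : set (set X) :=
  [set A | [/\ infinite_set A, countable A, A `<=` ~` [set x]
             & converges_to A x]].

Definition frechet_urysohn (X : topologicalType) : Prop :=
  forall (A : set X) (x : X), (closure A `\` A) x ->
    exists S : set X, [/\ infinite_set S, countable S, S `<=` A `\ x
                        & converges_to S x].

Definition alpha2 (X : topologicalType) : Prop :=
  forall (x : X) (S_ : nat -> set X), (forall n, Gamma x (S_ n)) ->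
    exists2 S : set X, Gamma x S & forall n, infinite_set (S_ n `&` S).

Definition separable (X : topologicalType) : Prop :=
  exists2 D : set X, countable D & dense D.

Definition H_separable (X : topologicalType) : Prop :=
  forall D : nat -> set X, (forall n, dense (D n)) ->
    exists F : nat -> set X,
      (forall n, finite_set (F n) /\ F n `<=` D n) /\
      (forall U : set X, open U -> U !=set0 ->
         finite_set [set n | ~ (F n `&` U !=set0)]).

(* Main.v *)
(** Fix [x] and dense sets [D n]. If [x] is not in [D n], the Frechet-Urysohn
    property gives a sequence in [D n] converging to [x]; the alpha_2 property
    yields one set [S] converging to [x] that meets all of these infinitely
    often, and points of [S] picked in [D n] with larger and larger index in an
    enumeration of [S] converge to [x]. So every [x] is the limit of some
    [p x n \in D n]. With a countable dense set [e_0, e_1, ...],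
    [F n = {p e_k n | k < n}] witnesses H-separability. *)
Require Import Defs.
From mathcomp Require Import all_boot all_classical topology.

Set Implicit Arguments.
Unset Strict Implicit.
Unset Printing Implicit Defensive.

Local Open Scope classical_set_scope.

Lemma finite_set_inj_lt (T : Type) (A : set T) (f : T -> nat) (n : nat) :
  set_inj A f -> finite_set [set y | A y /\ f y < n].
Proof.
move=> finj.
have /inj_card_eq/eq_finite_set <- :
    {in [set y | A y /\ f y < n] &, injective f}.
  by apply: sub_in2 finj => y; rewrite !inE => -[].
by apply: sub_finite_set (finite_II n) => _ [y [_ fyn] <-].
Qed.

Lemma infinite_set_inj_ge (T : Type) (A : set T) (f : T -> nat) (n : nat) :
  set_inj A f -> infinite_set A -> exists2 y, A y & n <= f y.
Proof.
move=> finj; apply: contra_notP => nA.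
apply: sub_finite_set (finite_set_inj_lt n finj) => y Ay; split=> //.
by rewrite ltnNge; apply/negP => nfy; apply: nA; exists y.
Qed.

Lemma finite_set_nat_bound (T : Type) (A : set T) (f : T -> nat) :
  finite_set A -> exists N, forall y, A y -> f y < N.
Proof.
move=> /(finite_image f)/finite_seqP[s fAs].
exists (\max_(i <- s) i).+1 => y Ay.
have : [set` s] (f y) by rewrite -fAs; exists y.
by move=> /= fys; rewrite ltnS; apply: (leq_bigmax_seq (F := id)).
Qed.

Lemma dense_Gamma (X : topologicalType) (D : set X) (x : X) :
  frechet_urysohn X -> dense D -> ~ D x -> exists2 S, Gamma x S & S `<=` D.
Proof.
move=> fuX dD nDx; have [|S [infS cS SD Sx]] := fuX D x.
  split=> // B; rewrite nbhsE => -[U [oU Ux] UB].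
  have [y [Uy Dy]] := dD U (ex_intro _ x Ux) oU.
  by exists y; split=> //; apply: UB.
by exists S => [|y /SD[]//]; split=> // y /SD[].
Qed.

Lemma dense_seq_cvg (X : topologicalType) (D : nat -> set X) (x : X) :
  frechet_urysohn X -> alpha2 X -> (forall n, dense (D n)) ->
  exists p : nat -> X, (forall n, D n (p n)) /\ p n @[n --> \oo] --> x.
Proof.
move=> fuX a2X dD.
(* If [x] lies in every [D n], [Gamma x] may be empty (as for isolated [x]), so a constant sequence
   is used. *)
have [Dx|/existsNP[m nDmx]] := pselect (forall n, D n x).
  by exists (fun=> x); split=> //; apply: cvg_cst.
(* [A0] is a filler for the indices with [D n x]: the alpha_2 property needs a member of [Gamma x]
   at every index. *)
have [A0 GA0 _] := dense_Gamma fuX (dD m) nDmx.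
have /choice[S_ S_P] n : exists S, Gamma x S /\ (D n x \/ S `<=` D n).
  have [Dnx|/(dense_Gamma fuX (dD n))[S GS SD]] := pselect (D n x).
    by exists A0; split=> //; left.
  by exists S; split=> //; right.
have [S [_ /countable_injP[f finj] _ Sx] SS] := a2X x S_ (fun n => (S_P n).1).
have /choice[p pP] n : exists y, D n y /\ (y = x \/ S y /\ n <= f y).
  have [_ [Dnx|SD]] := S_P n; first by exists x; split=> //; left.
  have [|y [Sny Sy] nfy] := @infinite_set_inj_ge _ (S_ n `&` S) f n _ (SS n).
    by apply: sub_in2 finj => y; rewrite !inE => -[].
  by exists y; split; [exact: SD|right].
exists p; split=> [n|B]; first exact: (pP n).1.
rewrite nbhsE => -[U [oU Ux] UB].
(* Only finitely many points of [S] miss [U], so [f] stays below some [N] on them, while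
   [n <= f (p n)]. *)
have [N ltN] := finite_set_nat_bound f (Sx U oU Ux).
exists N => // n /= Nn; apply: UB.
have [_ [->//|[Sp nfp]]] := pP n.
apply: contrapT => nU; have := ltN (p n) (conj Sp nU).
by rewrite ltnNge (leq_trans Nn nfp).
Qed.

Theorem proposition3p3 (X : topologicalType) :
  separable X -> frechet_urysohn X -> alpha2 X -> H_separable X.
Proof.
move=> [E /countable_injP[f finj] dE] fuX a2X D dD.
have [p pP] := choice (fun x => dense_seq_cvg x fuX a2X dD).
exists (fun n => (p ^~ n) @` [set e | E e /\ f e < n]); split=> [n|U oU U0].
  split; first exact/finite_image/finite_set_inj_lt.
  by move=> _ [e _ <-]; apply: (pP e).1.
have [e [Ue Ee]] := dE U U0 oU.
have [N _ pU] := (pP e).2 U (open_nbhs_nbhs (conj oU Ue)).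
(* From [N] on, [p e n] lies in [U]; once [f e < n], it also belongs to the [n]-th finite set. *)
apply: sub_finite_set (finite_II (maxn N (f e).+1)) => n /= nU.
rewrite ltnNge; apply/negP; rewrite geq_max => /andP[Nn fen].
by apply: nU; exists (p e n); split; [exists e|exact: pU].
Qed.
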